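(* Let $C\subset\mathbb{R}^n$ be a closed cone, let $K\subset C$ be nonempty, closed and unbounded, and let $f:C\to\mathbb{R}$ be continuous on $C$ and weakly homogeneous of degree $\alpha>0$ relative to $K$. If $\mathcal{K}(K,f)=\{0\}$, then the solution set $\operatorname{Sol}(K,f)$ is nonempty and bounded.
   Context: A cone is a nonempty set closed under multiplication by positive scalars. For a nonempty closed set $S\subset\mathbb{R}^n$, the asymptotic cone is $S^{\infty}=\{v\in\mathbb{R}^n:\exists t_k\to+\infty,\ \exists x^k\in S,\ \lim_{k\to\infty} x^k/t_k=v\}$. $f$ is weakly homogeneous of degree $\alpha>0$ relative to $K$ if there is a continuous function $h:C\to\mathbb{R}$, positively homogeneous of degree $\alpha$ (that is, $h(tx)=t^{\alpha}h(x)$ for all $x\in C$, $t>0$), such that $f(x)-h(x)=o(\|x\|^{\alpha})$ on $K$ (i.e. $(f(x)-h(x))/\|x\|^{\alpha}\to 0$ as $\|x\|\to\infty$ with $x\in K$). Any such $h$ is called an asymptotically homogeneous function of $f$ relative to $K$ and is denoted $f^{\infty}$; all such $h$ have the same values on $K^{\infty}$, so the kernel below does not depend on the choice. For a nonempty closed set $S$ and a continuous function $g$ on $S$, $\operatorname{Sol}(S,g)$ is the set of global minimizers of $g$ over $S$. The kernel is $\mathcal{K}(K,f):=\operatorname{Sol}(K^{\infty},f^{\infty})$. *)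

(* Defs.v *)
From mathcomp Require Export all_boot all_order all_algebra.
From mathcomp Require Export all_classical all_reals all_analysis.
From mathcomp Require Import ring.
Import Order.TTheory GRing.Theory Num.Theory.
Export numFieldNormedType.Exports.

Set Implicit Arguments.
Unset Strict Implicit.
Unset Printing Implicit Defensive.

Local Open Scope classical_set_scope.
Local Open Scope ring_scope.

Definition cone (R : realType) (n : nat) (C : set 'rV[R]_n) : Prop :=
  C !=set0 /\ forall (t : R) (x : 'rV[R]_n), 0 < t -> C x -> C (t *: x).

Definition asymptotic_cone (R : realType) (n : nat) (S : set 'rV[R]_n) :
    set 'rV[R]_n :=
  [set v | exists (t : nat -> R) (x : nat -> 'rV[R]_n),
     [/\ t k @[k --> \oo] --> +oo, forall k, S (x k)
       & (t k)^-1 *: x k @[k --> \oo] --> v]].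

(* The library norm on 'rV[R]_n is the maximum norm. *)
Definition enorm (R : realType) (n : nat) (x : 'rV[R]_n) : R :=
  Num.sqrt (\sum_(i < n) x ord0 i ^+ 2).

(* The filter of "x tends to infinity in norm, with x in K". *)
Definition infty_in (R : realType) (n : nat) (K : set 'rV[R]_n) :
    set_system 'rV[R]_n :=
  filter_from [set: R] (fun r => [set x | K x /\ r < enorm x]).

(* Functions with domain C are represented by total functions of which only the
   restriction to C matters. *)
Definition asymptotically_homogeneous (R : realType) (n : nat)
    (C K : set 'rV[R]_n) (alpha : R) (f h : 'rV[R]_n -> R) : Prop :=
  [/\ {within C, continuous h},
      forall (x : 'rV[R]_n) (t : R), C x -> 0 < t ->
        h (t *: x) = t `^ alpha * h x
    & (f x - h x) / enorm x `^ alpha @[x --> infty_in K] --> (0 : R)].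

Definition weakly_homogeneous (R : realType) (n : nat)
    (C K : set 'rV[R]_n) (alpha : R) (f : 'rV[R]_n -> R) : Prop :=
  exists h : 'rV[R]_n -> R, asymptotically_homogeneous C K alpha f h.

Definition Sol (R : realType) (n : nat) (S : set 'rV[R]_n)
    (g : 'rV[R]_n -> R) : set 'rV[R]_n :=
  [set x | S x /\ forall y, S y -> g x <= g y].

(* The asymptotically homogeneous function is not unique, but the choice does
   not matter: see kernelE below. *)
Definition kernel (R : realType) (n : nat) (C K : set 'rV[R]_n) (alpha : R)
    (f : 'rV[R]_n -> R) : set 'rV[R]_n :=
  [set v | exists2 h : 'rV[R]_n -> R,
     asymptotically_homogeneous C K alpha f h & Sol (asymptotic_cone K) h v].

Lemma enorm_continuous (R : realType) (n : nat) : continuous (@enorm R n).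
Proof.
have sumC (x : 'rV[R]_n) : \sum_(i < n) y ord0 i ^+ 2 @[y --> x] -->
    \sum_(i < n) x ord0 i ^+ 2.
  elim: (index_enum _) => [|i r ih].
    by rewrite big_nil; under eq_fun do rewrite big_nil; exact: cvg_cst.
  rewrite big_cons; under eq_fun do rewrite big_cons.
  apply: cvgD ih; rewrite expr2; under eq_fun do rewrite expr2.
  by apply: cvgM; exact: coord_continuous.
by move=> x; apply: (cvg_comp _ _ (sumC x)); exact: sqrt_continuous.
Qed.

Lemma enorm_gt0 (R : realType) (n : nat) (x : 'rV[R]_n) :
  x != 0 -> 0 < enorm x.
Proof.
move=> /eqP x0; rewrite sqrtr_gt0 lt_neqAle eq_sym sumr_ge0 ?andbT; last first.
  by move=> i _; exact: sqr_ge0.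
apply/eqP => s0; apply: x0; apply/rowP => i; rewrite mxE; apply/eqP.
rewrite -sqrf_eq0; apply/eqP.
by move: i (erefl true); apply: (psumr_eq0P _ s0) => j _; exact: sqr_ge0.
Qed.

Lemma enormZ (R : realType) (n : nat) (t : R) (x : 'rV[R]_n) :
  0 <= t -> enorm (t *: x) = t * enorm x.
Proof.
move=> t0; rewrite /enorm -[X in X * _](ger0_norm t0) -sqrtr_sqr -sqrtrM.
  by rewrite mulr_sumr; under eq_bigr do rewrite mxE exprMn.
exact: sqr_ge0.
Qed.

Lemma asymptotic_cone_sub (R : realType) (n : nat) (C K : set 'rV[R]_n) :
  cone C -> closed C -> K `<=` C -> asymptotic_cone K `<=` C.
Proof.
move=> [_ coneC] closedC KC v [t [x [/cvgryPgt tp Kx xv]]].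
apply: (closed_cvg C closedC _ _ xv).
near=> k; apply: coneC; last exact/KC/Kx.
by rewrite invr_gt0; near: k; exact: tp.
Unshelve. all: by end_near. Qed.

Lemma asymptotically_homogeneous_eq (R : realType) (n : nat)
    (C K : set 'rV[R]_n) (alpha : R) (f h1 h2 : 'rV[R]_n -> R) :
  cone C -> closed C -> K `<=` C -> 0 < alpha ->
  asymptotically_homogeneous C K alpha f h1 ->
  asymptotically_homogeneous C K alpha f h2 ->
  {in asymptotic_cone K, h1 =1 h2}.
Proof.
move=> coneC closedC KC alpha_gt0 [ch1 hom1 fh1] [ch2 hom2 fh2] v /set_mem Kv.
have Cv : C v by exact: (asymptotic_cone_sub coneC closedC KC).
have [v0|v0] := eqVneq v 0.
  have h0 (h : 'rV[R]_n -> R) :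
      (forall x t, C x -> 0 < t -> h (t *: x) = t `^ alpha * h x) -> h v = 0.
    move=> hom; have /eqP := hom v 2 Cv (ltr0Sn R 1).
    rewrite v0 scaler0 -subr_eq0 -{1}[h 0]mul1r -mulrBl mulf_eq0 => /orP[|/eqP//].
    rewrite subr_eq0 eq_sym => /eqP p1.
    have : 1 < 2 `^ alpha :> R.
      have := @gt0_ltr_powR R alpha alpha_gt0 1 2.
      by rewrite !nnegrE powR1 ler01 ler0n ltr1n; exact.
    by rewrite p1 ltxx.
  by rewrite !h0.
move: Kv => [t [x [tp Kx xv]]].
have t_gt0 : \forall k \near \oo, 0 < t k by move/cvgryPgt : tp; exact.
pose y k := (t k)^-1 *: x k.
have yv : y k @[k --> \oo] --> v by [].
have yE k : y k = (t k)^-1 *: x k by [].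
clearbody y.
have ev : enorm (y k) @[k --> \oo] --> enorm v.
  by apply: continuous_cvg => //; exact: enorm_continuous.
have xoo : x @ \oo --> infty_in K.
  move=> A [r _ rA]; apply: filterS (_ : \forall k \near \oo, r < enorm (x k)).
    by move=> k rk; apply: rA; split.
  have e2 : 0 < enorm v / 2 by rewrite divr_gt0// enorm_gt0.
  near=> k.
  have tk : 0 < t k by near: k.
  have -> : x k = t k *: y k by rewrite yE scalerA divff ?scale1r// gt_eqF.
  rewrite (enormZ _ (ltW tk)).
  apply: (@lt_le_trans _ _ (t k * (enorm v / 2))).
    rewrite -ltr_pdivrMr//; near: k; move/cvgryPgt : tp; exact.
  rewrite ler_pM2l//; apply/ltW; near: k; apply: (cvgr_gt _ ev).
  by rewrite gtr_pMr ?enorm_gt0// invf_lt1// ltr1n.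
pose d z := h1 z - h2 z.
pose psi k := d (x k) / enorm (x k) `^ alpha.
have psi0 : psi k @[k --> \oo] --> (0 : R).
  have -> : psi = (fun k => (f (x k) - h2 (x k)) / enorm (x k) `^ alpha -
                            (f (x k) - h1 (x k)) / enorm (x k) `^ alpha).
    by apply/funext => k; rewrite -mulrBl /psi /d; congr (_ / _); ring.
  by rewrite -[0]subr0; apply: cvgB;
    [exact: (cvg_comp _ _ xoo fh2)|exact: (cvg_comp _ _ xoo fh1)].
have dv : d (y k) @[k --> \oo] --> d v.
  have yC : y @ \oo --> within C (nbhs v).
    move=> A /= nA; have := yv _ nA; apply: filterS2 t_gt0 => k tk; apply.
    by rewrite yE; apply: coneC.2; [rewrite invr_gt0|exact/KC/Kx].
  move/subspace_continuousP : ch1 => /(_ v Cv) c1.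
  move/subspace_continuousP : ch2 => /(_ v Cv) c2.
  by apply: cvgB; [exact: (cvg_comp _ _ yC c1)|exact: (cvg_comp _ _ yC c2)].
apply/eqP; rewrite -subr_eq0; apply/eqP.
apply: (cvg_unique _ dv) => //.
pose M := (enorm v + 1) `^ alpha.
apply/norm_cvg0P.
apply: (@squeeze_cvgr _ _ _ _ (fun=> 0) (fun k => `|psi k| * M)).
- near=> k; rewrite normr_ge0/=.
  have tk : 0 < t k by near: k.
  have xe : x k = t k *: y k by rewrite yE scalerA divff ?scale1r// gt_eqF.
  have yC : C (y k) by rewrite yE; apply: coneC.2; [rewrite invr_gt0|exact/KC/Kx].
  have ey : 0 < enorm (y k) by near: k; apply: (cvgr_gt _ ev); exact: enorm_gt0.
  have -> : d (y k) = psi k * enorm (y k) `^ alpha.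
    rewrite /psi /d xe hom1// hom2// -mulrBr enormZ ?(ltW tk)//.
    rewrite powRM ?ltW//; field.
    by rewrite !gt_eqF ?powR_gt0.
  rewrite normrM ler_wpM2l// ger0_norm ?powR_ge0// ge0_ler_powR ?nnegrE ?ltW//.
    by rewrite addr_gt0// enorm_gt0.
  by near: k; apply: (cvgr_lt _ ev); rewrite ltrDl.
- exact: cvg_cst.
- by rewrite -[0](mul0r M); apply: cvgMr_tmp; apply/norm_cvg0P.
Unshelve. all: by end_near. Qed.

Lemma kernelE (R : realType) (n : nat) (C K : set 'rV[R]_n) (alpha : R)
    (f h : 'rV[R]_n -> R) :
  cone C -> closed C -> K `<=` C -> 0 < alpha ->
  asymptotically_homogeneous C K alpha f h ->
  kernel C K alpha f = Sol (asymptotic_cone K) h.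
Proof.
move=> coneC closedC KC alpha_gt0 fh; apply/seteqP; split=> v; last by exists h.
move=> [g fg [Kv gv]]; split=> // y Ky.
have gh := asymptotically_homogeneous_eq coneC closedC KC alpha_gt0 fg fh.
by rewrite -!gh ?inE//; exact: gv.
Qed.

(* Main.v *)
(* Sublevel sets of f on K are bounded: otherwise K has points x_k going to
   infinity with f(x_k) <= c, and the directions x_k / ||x_k|| accumulate at a
   unit vector v of the asymptotic cone.  Dividing f(x_k) <= c by ||x_k||^alpha
   gives f^oo(v) <= 0 in the limit, whereas 0 is a minimizer of f^oo with
   f^oo(0) = 0; so v is another minimizer, contradicting that the kernel is
   {0}. *)
Require Import Defs.
Import Order.TTheory GRing.Theory Num.Theory.

Set Implicit Arguments.
Unset Strict Implicit.
Unset Printing Implicit Defensive.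

Local Open Scope classical_set_scope.
Local Open Scope ring_scope.

(** Transfers bounds on [enorm] to the maximum norm, in which [bounded_set] is expressed. *)
Lemma norm_le_enorm (R : realType) (n : nat) (x : 'rV[R]_n) : `|x| <= enorm x.
Proof.
rewrite [leLHS]/Num.Def.normr/= mx_normrE bigmax_le ?sqrtr_ge0// => -[i j] _/=.
rewrite (ord1 i) -sqrtr_sqr ler_wsqrtr// (bigD1 j)//= lerDl.
by apply: sumr_ge0 => k _; exact: sqr_ge0.
Qed.

Lemma enorm_bounded (R : realType) (n : nat) (A : set 'rV[R]_n) (r : R) :
  (forall x, A x -> enorm x <= r) -> bounded_set A.
Proof.
move=> Ar; exists r; split=> [|M rM x Ax]; first exact: num_real.
apply: (le_trans (norm_le_enorm x)); apply: (le_trans (Ar x Ax)); exact: ltW.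
Qed.

Lemma enorm_sphere_compact (R : realType) (n : nat) :
  compact [set x : 'rV[R]_n | enorm x = 1].
Proof.
apply: bounded_closed_compact.
  by apply: (@enorm_bounded _ _ _ 1) => x /= ->.
apply: (@closed_comp _ _ (@enorm R n) [set 1]); last exact: closed_eq.
by move=> x _; exact: enorm_continuous.
Qed.

Lemma infty_in_proper_filter (R : realType) (n : nat) (K : set 'rV[R]_n) :
  (forall r, exists2 x, K x & r < enorm x) -> ProperFilter (infty_in K).
Proof.
move=> Koo; apply: filter_from_proper.
  apply: filter_from_filter; first by exists 0.
  move=> r s _ _; exists (Num.max r s) => // x [Kx].
  by rewrite gt_max => /andP[].
by move=> r _; have [x Kx rx] := Koo r; exists x.
Qed.

(** Normalization pushes [infty_in K] to a proper filter on the compact unit sphere; [v] is a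
    cluster point of it, and choice extracts the sequence. *)
Lemma unit_asymptotic_direction (R : realType) (n : nat) (K : set 'rV[R]_n) :
  (forall r, exists2 x, K x & r < enorm x) ->
  exists (v : 'rV[R]_n) (x : nat -> 'rV[R]_n),
    [/\ enorm v = 1, forall k, K (x k), enorm (x k) @[k --> \oo] --> +oo
      & (enorm (x k))^-1 *: x k @[k --> \oo] --> v].
Proof.
move=> /infty_in_proper_filter PF.
pose y (x : 'rV[R]_n) := (enorm x)^-1 *: x.
have far r : infty_in K [set x | K x /\ r < enorm x] by exists r.
have [|v [v1 cv]] := @enorm_sphere_compact R n (y @ infty_in K) _.
  exists 0 => // x [_ x0] /=.
  by rewrite enormZ ?invr_ge0 ?ltW// mulVf// gt_eqF.
(* Clustering makes the ball around [v] meet the directions of points of norm above [k]; the radius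
   uses [k.+1] to stay positive at [k = 0]. *)
have pick (k : nat) :
    exists x, [/\ K x, k%:R < enorm x & ball v k.+1%:R^-1 (y x)].
  have k0 : 0 < k.+1%:R^-1 :> R by rewrite invr_gt0.
  have [|_ [[x [Kx kx] <-] vx]] := cv (y @` [set x | K x /\ k%:R < enorm x])
    (ball v k.+1%:R^-1) _ (nbhsx_ballx v _ k0); last by exists x.
  by apply: filterS (far k%:R) => x ?; exists x.
have [x xP] := choice pick.
exists v, x; split=> // [k| |]; first by have [] := xP k.
- apply/cvgryPgt => A; near=> k.
  have [_ + _] := xP k; apply: lt_trans.
  by near: k; exact: nbhs_infty_gtr.
- apply/cvg_ballP => e e0; near=> k.
  have [_ _] := xP k; apply: le_ball; apply/ltW.
  by near: k; exact: near_infty_natSinv_lt (PosNum e0).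
Unshelve. all: by end_near. Qed.

Lemma homogeneous_at0 (R : realType) (n : nat) (C : set 'rV[R]_n) (alpha : R)
    (h : 'rV[R]_n -> R) :
  0 < alpha -> C 0 ->
  (forall (x : 'rV[R]_n) (t : R), C x -> 0 < t ->
    h (t *: x) = t `^ alpha * h x) ->
  h 0 = 0.
Proof.
move=> a0 C0 /(_ 0 2 C0 (ltr0Sn R 1))/eqP.
rewrite scaler0 -subr_eq0 -{1}[h 0]mul1r -mulrBl mulf_eq0 => /orP[|/eqP//].
rewrite subr_eq0 => /eqP p1.
have := @gt0_ltr_powR R alpha a0 1 2.
by rewrite !nnegrE powR1 -p1 ltxx ler01 ler0n ltr1n => /(_ isT isT isT).
Qed.

Lemma asymptotically_homogeneous_le0 (R : realType) (n : nat)
    (C K : set 'rV[R]_n) (alpha c : R) (f h : 'rV[R]_n -> R)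
    (x : nat -> 'rV[R]_n) (v : 'rV[R]_n) :
  cone C -> closed C -> K `<=` C -> 0 < alpha ->
  asymptotically_homogeneous C K alpha f h ->
  (forall k, K (x k)) -> (forall k, f (x k) <= c) ->
  enorm (x k) @[k --> \oo] --> +oo ->
  (enorm (x k))^-1 *: x k @[k --> \oo] --> v ->
  h v <= 0.
Proof.
move=> coneC closedC KC a0 [ch hom fh] Kx fx xoo xv.
pose e k := enorm (x k).
pose y k := (e k)^-1 *: x k.
have Cv : C v.
  by apply: (asymptotic_cone_sub coneC closedC KC); exists e, x.
have e_gt0 : \forall k \near \oo, 0 < e k by move/cvgryPgt : xoo; exact.
have hv : h (y k) @[k --> \oo] --> h v.
  (* [h] is continuous only relative to [C], so the directions must approach [v] inside [C]; they do
     once [e k] is positive. *)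
  have yC : y @ \oo --> within C (nbhs v).
    move=> A /= nA; have := xv _ nA; apply: filterS2 e_gt0 => k ek; apply.
    by apply: coneC.2; [rewrite invr_gt0|exact/KC/Kx].
  move/subspace_continuousP : ch => /(_ v Cv) cv.
  exact: (cvg_comp _ _ yC cv).
have xK : x @ \oo --> infty_in K.
  move=> A [r _ rA]; move/cvgryPgt : xoo => /(_ r).
  by apply: filterS => k rk; apply: rA; split.
have fhx : (f (x k) - h (x k)) / e k `^ alpha + h (y k) @[k --> \oo] --> h v.
  by rewrite -[h v]add0r; apply: cvgD hv; exact: (cvg_comp _ _ xK fh).
rewrite leNgt; apply/negP => hv0.
pose r := (Num.max c 0 / (h v / 2)) `^ alpha^-1.
have : \forall k \near \oo, False; last by case/filter_ex.
near=> k.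
have ek : 0 < e k by near: k.
have rk : r < e k by near: k; move/cvgryPgt : xoo; exact.
have : h v / 2 < (f (x k) - h (x k)) / e k `^ alpha + h (y k).
  by near: k; apply: (cvgr_gt _ fhx); rewrite gtr_pMr ?invf_lt1 ?ltr1n.
have hxE : h (x k) = e k `^ alpha * h (y k).
  rewrite -hom//; last first.
    by apply: coneC.2; [rewrite invr_gt0|exact/KC/Kx].
  by rewrite scalerA divff ?scale1r// gt_eqF.
have ea : 0 < e k `^ alpha by rewrite powR_gt0.
rewrite hxE mulrBl [_ * h (y k)]mulrC mulfK ?gt_eqF// subrK.
apply/negP; rewrite -leNgt ler_pdivrMr//.
apply: (le_trans (fx k)); apply: (@le_trans _ _ (Num.max c 0)).
  by rewrite le_max lexx.
have h2 : 0 < h v / 2 by rewrite divr_gt0.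
rewrite mulrC -ler_pdivrMr//.
have q0 : 0 <= Num.max c 0 / (h v / 2).
  by rewrite divr_ge0 ?(ltW h2)// le_max lexx orbT.
have -> : Num.max c 0 / (h v / 2) = r `^ alpha.
  by rewrite /r -powRrM mulVf ?gt_eqF// powRr1.
by rewrite ge0_ler_powR ?nnegrE ?powR_ge0// ltW.
Unshelve. all: by end_near. Qed.

Lemma sublevel_enorm_bounded (R : realType) (n : nat) (C K : set 'rV[R]_n)
    (f : 'rV[R]_n -> R) (alpha c : R) :
  cone C -> closed C -> K `<=` C -> 0 < alpha ->
  weakly_homogeneous C K alpha f -> kernel C K alpha f = [set 0] ->
  exists r, forall x, K x -> f x <= c -> enorm x <= r.
Proof.
move=> coneC closedC KC a0 [h fh]; rewrite (kernelE coneC closedC KC a0 fh).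
move=> kerE; apply: contrapT => unb.
have [K0 h0min] : Sol (asymptotic_cone K) h 0 by rewrite kerE.
have h0 : h 0 = 0.
  have [_ hom _] := fh.
  by apply: homogeneous_at0 hom => //; exact: asymptotic_cone_sub K0.
(* Directions are taken in the sublevel set, not in [K], so that the bound on [f] holds along the
   sequence. *)
pose L := [set x | K x /\ f x <= c].
have [|v [x [v1 Lx xoo xv]]] := @unit_asymptotic_direction R n L.
  move=> r; apply: contrapT => Lr; apply: unb; exists r => x Kx fx.
  by rewrite leNgt; apply/negP => rx; apply: Lr; exists x.
have Kx k : K (x k) by have [] := Lx k.
have fx k : f (x k) <= c by have [] := Lx k.
have hv : h v <= 0.
  exact: asymptotically_homogeneous_le0 fh Kx fx xoo xv.
have : Sol (asymptotic_cone K) h v.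
  split; first by exists (fun k => enorm (x k)), x.
  by move=> w Kw; apply: (le_trans hv); rewrite -h0; exact: h0min.
(* Writing 0 as a zero multiple lets [enormZ] give norm 0, against [enorm v = 1]. *)
rewrite kerE => /= v0; move: v1; rewrite v0 -(scale0r 0) enormZ// mul0r.
by move/eqP; rewrite eq_sym oner_eq0.
Qed.

Theorem theorem4p1 (R : realType) (n : nat) (C K : set 'rV[R]_n)
    (f : 'rV[R]_n -> R) (alpha : R) :
  cone C -> closed C ->
  K `<=` C -> K !=set0 -> closed K -> ~ bounded_set K ->
  {within C, continuous f} ->
  0 < alpha -> weakly_homogeneous C K alpha f ->
  kernel C K alpha f = [set 0] ->
  Sol K f !=set0 /\ bounded_set (Sol K f).
Proof.
move=> coneC closedC KC [x0 Kx0] closedK _ cf a0 wh kerE.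
(* The level [f x0] serves twice: its sublevel set contains every minimizer, and it confines the
   search for one to a compact set. *)
have [r rP] := sublevel_enorm_bounded (f x0) coneC closedC KC a0 wh kerE.
split; last first.
  by apply: (@enorm_bounded _ _ _ r) => x [Kx xmin]; rewrite rP// xmin.
pose A := K `&` [set x | enorm x <= r].
have Ax0 : A x0 by split=> //; exact: rP.
have compactA : compact A.
  apply: bounded_closed_compact.
    by apply: (@enorm_bounded _ _ _ r) => x [].
  apply: closedI => //.
  apply: (@closed_comp _ _ (@enorm R n) [set t | t <= r]); last exact: closed_le.
  by move=> x _; exact: enorm_continuous.
have cfA : {within A, continuous f}.
  by apply: continuous_subspaceW cf => x [/KC].
have [x /set_mem[Kx _] xmin] :=
  compact_EVT_min (ex_intro _ x0 Ax0) compactA cfA.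
exists x; split=> // y Ky.
(* Either [y] lies in [A], or [f y] exceeds [f x0], which is at least [f x] because [x0] is in
   [A]. *)
have [fy|/ltW fy] := leP (f y) (f x0).
  by apply: xmin; apply/mem_set; split=> //; exact: rP.
by apply: le_trans fy; apply: xmin; exact/mem_set.
Qed.
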